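(* Let $B=B(m)$ satisfy $B=o(m^{1/2})$. Then the approximation ratio of any reasonable iterative path minimizing algorithm for the unsplittable flow problem on directed graphs cannot be better than $\frac{e}{e-1}-o(1)$; that is, for every such algorithm there are directed instances with $m$ edges, all edge capacities equal to $B$, in which the ratio between the optimal value and the value of the algorithm's output is at least $\frac{e}{e-1}-o(1)$ (as $m\to\infty$).
   Context: Unsplittable flow problem: the input is a (here directed) graph $G=(V,E)$ with $m=|E|$, a positive capacity $c_e$ for each edge, and a set $\mathcal{R}$ of requests $r=(s_r,t_r,d_r,v_r)$ (source, target, demand, value). A feasible solution selects a subset of requests and an $s_r$–$t_r$ path for each, such that on every edge the total demand of selected requests routed through it is at most its capacity; the value is the sum of values of selected requests. Let $S$ be the set of all simple paths between $s_r$ and $t_r$ over all $r\in\mathcal{R}$. A function $g:S\to\mathbb{R}$ (which may depend on the current partial routing) is reasonable if, whenever all edge capacities are identical and every request has demand 1 and value 1, then for any valid unsplittable flow and any two paths $q,q'\in S$ such that $q$ has $k$ edges, $q'$ has $k'$ edges, $k\le k'$, and $f_i\le f'_i$ for all $1\le i\le k$, where $(f_1,\dots,f_k)$ and $(f'_1,\dots,f'_{k'})$ are the non-increasingly sorted vectors of flow routed through the edges of $q$ and $q'$ respectively in that flow, we have $g(q)\le g(q')$. A reasonable iterative path minimizing algorithm is one that iteratively selects (and routes along) a path minimizing a reasonable function over all paths corresponding to not-yet-selected requests. *)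

(* Defs.v *)
From HB Require Import structures.
From mathcomp Require Import all_boot all_order all_algebra.
From mathcomp Require Import all_classical all_reals all_analysis.
Set Implicit Arguments.
Unset Strict Implicit.
Unset Printing Implicit Defensive.
Import Order.TTheory GRing.Theory Num.Theory.
Import numFieldNormedType.Exports.
Local Open Scope classical_set_scope.
Local Open Scope ring_scope.

(* Graphs are directed, without loops or parallel edges.  The requests form an
   indexed family, so several requests may have equal data. *)
Record instance (R : realType) := Instance {
  vertex : finType;
  edges : {set vertex * vertex};
  capacity : vertex * vertex -> R;
  request : finType;
  source : request -> vertex;
  target : request -> vertex;
  demand : request -> R;
  reward : request -> R;
  edges_loopless : forall v, (v, v) \notin edges;
  capacity_gt0 : forall e, e \in edges -> 0 < capacity e;
  demand_gt0 : forall r, 0 < demand r;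
  reward_gt0 : forall r, 0 < reward r }.

Section UnsplittableFlow.
Variables (R : realType) (I : instance R).

(* A path is the sequence of all its vertices, both endpoints included. *)
Definition simple_path (s t : vertex I) (q : seq (vertex I)) : bool :=
  if q is x :: p then
    [&& x == s, last x p == t, path (fun u v => (u, v) \in edges I) x p
      & uniq (x :: p)]
  else false.

Definition request_path (r : request I) (q : seq (vertex I)) : bool :=
  simple_path (source r) (target r) q.

Definition path_edges (q : seq (vertex I)) : seq (vertex I * vertex I) :=
  zip q (behead q).

(* [None] marks a request that is not selected. *)
Definition routing := {ffun request I -> option (seq (vertex I))}.

Definition flow (f : routing) (e : vertex I * vertex I) : R :=
  \sum_(r | if f r is Some q then e \in path_edges q else false) demand r.

Definition feasible (f : routing) : Prop :=
  (forall r q, f r = Some q -> request_path r q) /\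
  (forall e, e \in edges I -> flow f e <= capacity e).

Definition value (f : routing) : R := \sum_(r | isSome (f r)) reward r.

Definition opt : R := sup [set value f | f in [set f | feasible f]].

Definition no_routing : routing := [ffun => None].

Definition route (f : routing) (r : request I) (q : seq (vertex I)) : routing :=
  [ffun r' => if r' == r then Some q else f r'].

Definition sorted_flows (f : routing) (q : seq (vertex I)) : seq R :=
  sort (fun x y => y <= x) [seq flow f e | e <- path_edges q].

Definition unit_instance : Prop :=
  [/\ exists c, forall e, e \in edges I -> capacity e = c,
      forall r : request I, demand r = 1
    & forall r : request I, reward r = 1].

End UnsplittableFlow.

(* The function minimized by the algorithm.  It may depend on the instance, on
   the current partial routing, and on the request that a path serves (hence on
   its demand and value); only its values on request paths matter. *)
Definition path_function (R : realType) :=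
  forall I : instance R, routing I -> request I -> seq (vertex I) -> R.

Definition reasonable (R : realType) (g : path_function R) : Prop :=
  forall I : instance R, unit_instance I ->
  forall f : routing I, feasible f ->
  forall (r r' : request I) (q q' : seq (vertex I)),
    request_path r q -> request_path r' q' ->
    (size (path_edges q) <= size (path_edges q'))%N ->
    (forall i, (i < size (path_edges q))%N ->
       (sorted_flows f q)`_i <= (sorted_flows f q')`_i) ->
    g I f r q <= g I f r' q'.

(* Ties are broken arbitrarily, so one function [g] may have several runs.
   Every selected path is minimal among all paths of the unselected requests,
   whether or not those fit in the residual capacity. *)
Inductive run (R : realType) (g : path_function R) (I : instance R) :
    routing I -> Prop :=
| run_start : run g (no_routing I)
| run_step (f : routing I) (r : request I) (q : seq (vertex I)) :
    run g f ->
    f r = None -> request_path r q ->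
    (forall r' q', f r' = None -> request_path r' q' ->
       g I f r q <= g I f r' q') ->
    feasible (route f r q) ->
    run g (route f r q).

(* A run is over once no unselected request can be routed any more. *)
Definition output (R : realType) (g : path_function R) (I : instance R)
    (f : routing I) : Prop :=
  run g f /\
  forall r q, f r = None -> request_path r q -> ~ feasible (route f r q).

(* Main.v *)
Require Import Defs.
From HB Require Import structures.
From mathcomp Require Import all_boot all_order all_algebra.
From mathcomp Require Import all_classical all_reals all_analysis.
From mathcomp Require Import zify ring lra.
Set Implicit Arguments.
Unset Strict Implicit.
Unset Printing Implicit Defensive.
Import Order.TTheory GRing.Theory Num.Theory.
Import numFieldNormedType.Exports.
Local Open Scope classical_set_scope.
Local Open Scope ring_scope.

(* Sources s_i and hubs v_i (i < l) carry heights in {0, .., b}, where b is the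
   integer part of the capacity; s_i has an edge to v_j iff height s_i <=
   height v_j, every hub has an edge to the common sink, and each source has at
   most b requests.  Routing every request of s_i through v_i is feasible.  For
   k < b, there is exactly one request at a source of height k for each hub of
   height > k.  Serving the requests by increasing height k, the one attached to
   v_j through v_j, always routes along a path whose sorted flow vector (k, 0)
   is dominated by that of every other available path, so a reasonable function
   allows it; hubs of height h end with flow h.  The requests at sources of
   height b then face only full hubs.  If M_i is the number of hubs of height at
   least b - i, all sources of height b - 1 - i together need capacity for M_i
   requests, which holds when M_(i+1) = M_i + M_i / b + 1.  Then
   M_b <= (n + b) e - b for n = M_0, the algorithm serves
   sum_(i < b) M_i <= b (M_b - M_0) <= (e - 1) b (n + b) requests, b n requests
   are lost, and b = o(n) for n of order sqrt m. *)

(** * Values and flows under unit demands *)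

Section UnitDemands.
Variables (R : realType) (I : instance R).

Lemma value_unit (f : routing I) :
  unit_instance I -> value f = #|[pred r | isSome (f r)]|%:R.
Proof.
case=> _ _ hv; rewrite /value (eq_bigr (fun=> 1)) => [|r _]; last exact: hv.
by rewrite sumr_const.
Qed.

Lemma flow_unit (f : routing I) e : unit_instance I ->
  flow f e =
    #|[pred r | if f r is Some q then e \in path_edges q else false]|%:R.
Proof.
case=> _ hd _; rewrite /flow (eq_bigr (fun=> 1)) => [|r _]; last exact: hd.
by rewrite sumr_const.
Qed.

Lemma value_le_opt (f : routing I) : feasible f -> value f <= opt I.
Proof.
move=> ff; apply: ub_le_sup; last by exists f.
exists (\sum_(r : request I) reward r) => _ [h _ <-].
rewrite /value big_mkcond; apply: ler_sum => r _.
by case: ifP => // _; exact/ltW/reward_gt0.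
Qed.

End UnitDemands.

(** * The hub graph: its paths, flows and feasible routings *)

Section HubGraph.
Variables (R : realType) (c : R) (l b D : nat) (T : finType).
Variables (src dst : T -> 'I_l) (grp : 'I_l -> nat).
Hypothesis c_gt0 : 0 < c.

(* The [D] leaves behind the sink only pad the number of edges. *)
Definition node := ('I_l + 'I_l + option 'I_D)%type.
Definition entry (i : 'I_l) : node := inl (inl i).
Definition hub (j : 'I_l) : node := inl (inr j).
Definition sink : node := inr None.

Definition arc (u w : node) : bool :=
  match u, w with
  | inl (inl i), inl (inr j) => (grp i <= grp j)%N
  | inl (inr _), inr None => true
  | inr None, inr (Some _) => true
  | _, _ => false
  end.

Lemma arc_loopless v :
  (v, v) \notin [set e : node * node | arc e.1 e.2]%SET.
Proof. by rewrite inE; case: v => [[]|[]]. Qed.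

Definition hub_instance : instance R :=
  @Instance R node [set e : node * node | arc e.1 e.2]%SET (fun=> c) T
    (fun r => entry (src r)) (fun=> sink) (fun=> 1) (fun=> 1)
    arc_loopless (fun _ _ => c_gt0) (fun=> ltr01) (fun=> ltr01).

Lemma hub_unit : unit_instance hub_instance.
Proof. by split=> //; exists c. Qed.

Definition hub_path (i j : 'I_l) : seq (vertex hub_instance) :=
  [:: entry i; hub j; sink].

Lemma hub_pathP (r : request hub_instance) q :
  reflect (exists2 j, (grp (src r) <= grp j)%N & q = hub_path (src r) j)
    (request_path r q).
Proof.
apply: (iffP idP) => [|[j hj ->]]; last first.
  by rewrite /request_path /= !inE /= hj !eqxx.
case: q => [|x p] //= /and4P[/eqP-> + + _].
case: p => [|[[i|j]|y] p] //=; try by rewrite inE.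
case: p => [|z p] //= + /and3P[]; rewrite !inE /= => + hj.
case: z => [[|]|[|]] //; case: p => [_ _ _|w p] /=; first by exists j.
rewrite inE /=; case: w => [|[d|]] //=.
by case: p => [|y p] //= _ _; rewrite inE.
Qed.

Definition hub_routing (A : {set T}) (h : T -> 'I_l) : routing hub_instance :=
  [ffun r => if r \in A then Some (hub_path (src r) (h r)) else None].

Lemma value_hub A h : value (hub_routing A h) = #|A|%:R.
Proof.
rewrite value_unit; last exact: hub_unit.
congr _%:R; apply: eq_card => r; rewrite !inE ffunE.
by case: (r \in A).
Qed.

Lemma flow_hub_sink A h j : flow (hub_routing A h) (hub j, sink) =
  #|[pred r in A | h r == j]|%:R.
Proof.
rewrite flow_unit; last exact: hub_unit.
congr _%:R; apply: eq_card => r; rewrite !inE ffunE.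
case: (r \in A) => //=; rewrite !inE /= xpair_eqE eqxx andbT.
by rewrite eq_sym.
Qed.

Lemma flow_entry_hub A h i j : flow (hub_routing A h) (entry i, hub j) =
  #|[pred r in A | (src r == i) && (h r == j)]|%:R.
Proof.
rewrite flow_unit; last exact: hub_unit.
congr _%:R; apply: eq_card => r; rewrite !inE ffunE.
case: (r \in A) => //=; rewrite !inE /= xpair_eqE orbF.
by congr (_ && _); rewrite eq_sym.
Qed.

(** Whatever enters a hub goes on to the sink. Hence only the hub-to-sink edges can be tight, and
    they come first in the sorted flow vectors. *)
Lemma flow_entry_le A h i j :
  flow (hub_routing A h) (entry i, hub j) <=
  flow (hub_routing A h) (hub j, sink).
Proof.
rewrite flow_hub_sink flow_entry_hub ler_nat.
by apply/subset_leq_card/fintype.subsetP => r; rewrite !inE => /and3P[-> _ ->].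
Qed.

Lemma hub_feasible (A : {set T}) h : b%:R <= c ->
  {in A, forall r, (grp (src r) <= grp (h r))%N} ->
  (forall j, #|[pred r in A | h r == j]| <= b)%N ->
  feasible (hub_routing A h).
Proof.
move=> bc hA hb; split=> [r q|[u w] /=].
  rewrite ffunE; case: ifP => // rA [<-].
  by apply/hub_pathP; exists (h r) => //; apply: hA.
have hs j : flow (hub_routing A h) (hub j, sink) <= c.
  by rewrite flow_hub_sink; apply: le_trans bc; rewrite ler_nat.
rewrite inE; case: u w => [[i|j]|[d|]] [[i'|j']|[d'|]] //= _.
- exact: le_trans (flow_entry_le _ _ _ _) (hs _).
- exact: hs.
rewrite flow_unit; last exact: hub_unit.
rewrite eq_card0 => [|r]; first exact: ltW.
by rewrite !inE ffunE; case: ifP.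
Qed.

Lemma sorted_flows_hub (A : {set T}) h i j :
  sorted_flows (hub_routing A h) (hub_path i j) =
  [:: flow (hub_routing A h) (hub j, sink);
      flow (hub_routing A h) (entry i, hub j)].
Proof.
rewrite /sorted_flows /sort /=.
have := flow_entry_le A h i j.
set x := flow _ _; set y := flow _ _; rewrite le_eqVlt => /predU1P[->|xy].
  by rewrite lexx.
by rewrite leNgt xy.
Qed.

Lemma card_hub_edges : #|edges hub_instance| =
  (#|[pred p : 'I_l * 'I_l | (grp p.1 <= grp p.2)%N]| + l + D)%N.
Proof.
pose e (x : {p : 'I_l * 'I_l | (grp p.1 <= grp p.2)%N} + 'I_l + 'I_D) :
    node * node :=
  match x with
  | inl (inl p) => (entry (val p).1, hub (val p).2)
  | inl (inr j) => (hub j, sink)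
  | inr d => (sink, inr (Some d))
  end.
have e_inj : injective e.
  move=> [[p|j]|d] [[p'|j']|d'] //= [].
  - move=> h1 h2; do 2!congr inl; apply: val_inj; apply/eqP.
    by rewrite -pair_eqE /pair_eq h1 h2 !eqxx.
  - by move=> ->.
  - by move=> ->.
transitivity #|(e @: [set: _])%SET|.
  apply: eq_card => -[u w]; rewrite inE /=; apply/idP/imsetP => [|[x _]].
    case: u w => [[i|j]|[d|]] [[i'|j']|[d'|]] //= h.
    + by exists (inl (inl (Sub (i, j') h))).
    + by exists (inl (inr j)).
    + by exists (inr d').
  by case: x => [[[p hp]|j]|d] /= [-> ->] //.
by rewrite card_imset // cardsT !card_sum card_sig !card_ord.
Qed.

(** * Serving the requests by increasing height *)

Section Schedule.
Variable g : path_function R.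
Hypothesis g_reasonable : reasonable g.
Hypotheses (b_le : b%:R <= c) (b_max : c < b.+1%:R).
Hypothesis src_load : forall i, (#|[pred r | src r == i]| <= b)%N.

Definition routed : {set T} := [set r | (grp (src r) < b)%N]%SET.

Hypothesis dst_up : {in routed, forall r, (grp (src r) < grp (dst r))%N}.
Hypothesis hit : forall j k, (k < grp j)%N ->
  exists2 r, grp (src r) = k & dst r = j.
Hypothesis hit_inj : {in routed &, forall r r',
  grp (src r) = grp (src r') -> dst r = dst r' -> r = r'}.

(** By [hit_inj], requests of [A] sent to the same hub start at distinct heights, here all below
    [k]. *)
Lemma load_le (A : {set T}) j k : A \subset routed ->
  (forall r, r \in A -> dst r = j -> (grp (src r) < k)%N) ->
  (#|[pred r in A | dst r == j]| <= k)%N.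
Proof.
move=> /fintype.subsetP Ar hk; rewrite cardE -(size_map (fun r => grp (src r))).
rewrite -[leqRHS](size_iota 0); apply: uniq_leq_size => [|x].
  rewrite map_inj_in_uniq ?enum_uniq // => r r'.
  rewrite !mem_enum !inE => /andP[rA /eqP rj] /andP[r'A /eqP r'j] /hit_inj.
  by apply; rewrite ?Ar // rj.
case/mapP=> r; rewrite mem_enum inE mem_iota => /andP[rA /eqP rj] ->.
exact: hk.
Qed.

Lemma load_ge (A : {set T}) j k :
  (forall r, (grp (src r) < k)%N -> dst r = j -> r \in A) ->
  (k <= grp j)%N -> (k <= #|[pred r in A | dst r == j]|)%N.
Proof.
move=> hA kj; rewrite cardE -(size_map (fun r => grp (src r))).
rewrite -[leqLHS](size_iota 0); apply: uniq_leq_size; first exact: iota_uniq.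
move=> x; rewrite mem_iota /= => xk.
have [r rx rj] := hit (leq_trans xk kj).
by apply/mapP; exists r; rewrite // mem_enum inE hA ?rj ?rx ?eqxx.
Qed.

Lemma feasible_dst (A : {set T}) : A \subset routed ->
  feasible (hub_routing A dst).
Proof.
move=> Ar; apply: hub_feasible => // [r rA|j].
  by apply/ltnW/dst_up/(fintype.subsetP Ar).
apply: load_le => // r rA _.
by have := fintype.subsetP Ar _ rA; rewrite inE.
Qed.

(** Induction on the size of [A]: a request of maximal source height can be taken as the last one
    served, since removing it keeps [A] closed under passing to lower heights. *)
Lemma run_dst (A : {set T}) : A \subset routed ->
  (forall r r', r \in A -> (grp (src r') < grp (src r))%N -> r' \in A) ->
  run g (hub_routing A dst).
Proof.
have [n] := ubnP #|A|; elim: n A => // n IHn A An Ar Adown.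
have [->|[r0 r0A]] := set_0Vmem A.
  suff -> : hub_routing finset.set0 dst = no_routing hub_instance.
    exact: run_start.
  by apply/ffunP => r; rewrite !ffunE inE.
case: (arg_maxnP (fun r => grp (src r)) r0A) => r rP rmax {r0 r0A}.
have {rP} rA : r \in A := rP.
set k := grp (src r).
pose A' := (A :\ r)%SET.
have A'r : A' \subset routed by apply: fintype.subset_trans Ar; exact: subsetDl.
have rr := fintype.subsetP Ar _ rA.
have A'low r' : (grp (src r') < k)%N -> r' \in A'.
  move=> r'k; rewrite !inE (Adown r) // andbT.
  by apply: contraTneq r'k => ->; rewrite ltnn.
(* All requests below height [k] are already served, so each hub that is still reachable has
   received one from every height below [k]. *)
have level j : (k <= grp j)%N ->
    k%:R <= flow (hub_routing A' dst) (hub j, sink).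
  by move=> kj; rewrite flow_hub_sink ler_nat load_ge // => r' /A'low.
have routeE : route (hub_routing A' dst) r (hub_path (src r) (dst r)) =
    hub_routing A dst.
  apply/ffunP => r'; rewrite !ffunE !inE.
  by have [->|//] := eqVneq r' r; rewrite rA.
rewrite -routeE; apply: run_step; last by rewrite routeE; apply: feasible_dst.
- apply: IHn => //.
    by have := cardsD1 r A; rewrite rA add1n => cA; rewrite -ltnS -cA.
  move=> r' r'' r'A' r''r'; apply: A'low; apply: leq_trans r''r' _.
  by apply: rmax; move: r'A'; rewrite !inE => /andP[].
- by rewrite ffunE !inE eqxx.
- by apply/hub_pathP; exists (dst r) => //; exact/ltnW/dst_up.
- move=> r' q' r'N /hub_pathP[j' hj' ->].
  apply: g_reasonable => //.
  + exact: hub_unit.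
  + exact: feasible_dst.
  + by apply/hub_pathP; exists (dst r) => //; exact/ltnW/dst_up.
  + by apply/hub_pathP; exists j'.
  have kr' : (k <= grp (src r'))%N.
    rewrite leqNgt; apply/negP => /A'low; move: r'N.
    by rewrite ffunE; case: ifP.
  (* Larger entry: the hub of [r] carries at most [k], as [r] is the only request of height [k]
     attached to it. Smaller entry: the edge from the source of [r] to this hub is still empty. *)
  rewrite !sorted_flows_hub => -[_|[_|//]] /=.
    apply: le_trans (level _ (leq_trans kr' hj')).
    rewrite flow_hub_sink ler_nat; apply: load_le => // r''.
    rewrite !inE => /andP[r''r r''A] r''j.
    have : (grp (src r'') <= k)%N by exact: rmax.
    case: ltngtP => // r''k _.
    have r''rr := fintype.subsetP Ar _ r''A.
    by move: r''r; rewrite (hit_inj r''rr rr r''k r''j) eqxx.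
  rewrite !flow_entry_hub ler_nat eq_card0 // => r''.
  rewrite !inE; apply/negP 
    => /andP[/andP[r''r r''A]] /andP[/eqP r''i /eqP r''j].
  have r''rr := fintype.subsetP Ar _ r''A.
  by move: r''r; rewrite (hit_inj r''rr rr _ r''j) ?eqxx ?r''i.
Qed.

Lemma output_dst : output g (hub_routing routed dst).
Proof.
split.
  apply: run_dst => // r r'; rewrite !inE => rb r'r; exact: ltn_trans rb.
move=> r q; rewrite ffunE; case: ifP => //; rewrite inE => /negbT.
rewrite -leqNgt => br _ /hub_pathP[j hj ->].
case=> _ /(_ (hub j, sink)); rewrite inE => /(_ isT) /=.
(* An unserved request starts at height at least [b], so its hub already carries [b]; one more unit
   gives [b.+1], above the capacity. *)
apply/negP; rewrite -ltNge; apply: lt_le_trans b_max _.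
set f := hub_routing routed dst.
suff : flow f (hub j, sink) + 1 <=
    flow (route f r (hub_path (src r) j)) (hub j, sink).
  apply: le_trans; rewrite -natr1 lerD2r flow_hub_sink ler_nat load_ge //.
    by move=> r'; rewrite inE.
  exact: leq_trans br hj.
rewrite !flow_unit; try exact: hub_unit.
rewrite natr1 ler_nat [leqRHS](cardD1 r) !inE !ffunE eqxx /= !inE /=.
rewrite !xpair_eqE !eqxx /= add1n ltnS.
apply/subset_leq_card/fintype.subsetP => r'; rewrite !inE !ffunE.
by case: (eqVneq r' r) => // ->; rewrite inE ltnNge br.
Qed.

(** Sending each request through the hub with the index of its source loads that hub with the
    requests of one source, at most [b] of them. *)
Lemma opt_ge : #|T|%:R <= opt hub_instance.
Proof.
rewrite -cardsT -(value_hub _ src); apply: value_le_opt.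
apply: hub_feasible => // j; apply: leq_trans (src_load j).
by apply/subset_leq_card/fintype.subsetP => r; rewrite !inE.
Qed.

End Schedule.

End HubGraph.

(** * Layer sizes, heights and their growth *)

Section Layers.
Variables (n b : nat).

(** [layer i] is M_i. The increment is a number of sources sufficient for M_i requests at [b] per
    source. *)
Fixpoint layer (i : nat) : nat :=
  if i is i'.+1 then (layer i' + (layer i' %/ b).+1)%N else n.

(** If no layer below [b] contains [x], [find] returns [b], which gives height 0. *)
Definition rank (x : nat) : nat := find (fun i => x < layer i)%N (iota 0 b).

Definition height (x : nat) : nat := (b - rank x)%N.

Lemma layer_mono : {homo layer : i j / (i <= j)%N}.
Proof.
apply: homo_leq => [x|y x z|i]; [exact: leqnn|exact: leq_trans|].
exact: leq_addr.
Qed.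

Lemma height_gt x i : (i < b)%N -> (x < layer i)%N = (b - i <= height x)%N.
Proof.
move=> ib.
have -> : (b - i <= height x)%N = (rank x <= i)%N.
  have : (rank x <= b)%N by rewrite -[leqRHS](size_iota 0) find_size.
  by rewrite /height; lia.
apply/idP/idP => [xi|ri].
  rewrite leqNgt; apply/negP => /(before_find 0%N).
  by rewrite nth_iota // add0n xi.
have hr : has (fun i => x < layer i)%N (iota 0 b).
  by rewrite has_find size_iota; apply: leq_ltn_trans ri ib.
have := nth_find 0%N hr; rewrite -/(rank x) nth_iota ?(leq_ltn_trans ri ib) //.
by rewrite add0n => /leq_trans; apply; apply: layer_mono.
Qed.

Lemma height_le x : (height x <= b)%N.
Proof. exact: leq_subr. Qed.

Lemma height_layer x i : (i < b)%N -> (layer i <= x)%N -> (x < layer i.+1)%N ->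
  height x = (b - i.+1)%N.
Proof.
move=> ib ix xi.
have h1 := height_gt x ib.
(* If [i.+1] equals [b], then [h1] alone forces height 0. *)
have [ib'|bi] := ltnP i.+1 b; last by lia.
by have h2 := height_gt x ib'; lia.
Qed.

Hypothesis b_gt0 : (0 < b)%N.

(** Each M_i is at most b (M_(i+1) - M_i), and these differences telescope. *)
Lemma sum_layer : (\sum_(i < b) layer i + b * n <= b * layer b)%N.
Proof.
suff: forall k, (\sum_(i < k) layer i + b * n <= b * layer k)%N by apply.
elim=> [|k IHk]; first by rewrite big_ord0.
rewrite big_ord_recr /= addnAC mulnDr; apply: leq_add => //.
by rewrite mulnC ltnW // ltn_ceil.
Qed.

(** The shift by [b] absorbs the rounding: M_(i+1) + b <= (M_i + b) (1 + 1/b), and (1 + 1/b)^b <=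
    e. *)
Lemma layer_growth (R : realType) :
  (layer b + b)%:R <= (n + b)%:R * expR 1 :> R.
Proof.
have b0 : (0 : R) < b%:R by rewrite ltr0n.
have step k : (layer k + b)%:R <= (n + b)%:R * (1 + b%:R^-1) ^+ k :> R.
  elim: k => [|k IHk]; first by rewrite expr0 mulr1.
  rewrite exprSr mulrA; apply: le_trans (ler_wpM2r _ IHk); last first.
    by rewrite addr_ge0 // invr_ge0 ltW.
  rewrite mulrDr mulr1 /= addnAC natrD lerD2l ler_pdivlMr // -natrM ler_nat.
  by rewrite mulSn addnC leq_add2r leq_divM.
apply: le_trans (step b) _; apply: ler_wpM2l; first by [].
have -> : expR 1 = expR b%:R^-1 ^+ b :> R.
  by rewrite -expRM_natl divff ?gt_eqF.
by apply: lerXn2r; rewrite ?nnegrE ?expR_ge0 ?expR_ge1Dx.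
Qed.

End Layers.

(** * The requests and their sources *)

Section LayeredRequests.
Variables n b : nat.
Hypothesis b_gt0 : (0 < b)%N.

(** A pair (i, j) stands for the request attached to hub [j] from height b - i - 1; the condition
    says that the height of [j] is at least b - i. The right summand of [layered_request] puts [b]
    requests at each of the [n] sources of height [b]. *)
Definition level_request : Type :=
  {p : 'I_b * 'I_(layer n b b) | (p.2 < layer n b p.1)%N}.

Definition layered_request : Type := (level_request + 'I_b * 'I_n)%type.

(** Requests of level i are packed, [b] consecutive hubs per source, into the sources from [layer i]
    on. *)
Definition origin (r : layered_request) : nat :=
  match r with
  | inl p => (layer n b (val p).1 + (val p).2 %/ b)%N
  | inr q => q.2
  end.

Lemma origin_level (p : level_request) :
  (layer n b (val p).1 <= origin (inl p) < layer n b (val p).1.+1)%N.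
Proof.
case: p => -[i j] /= ji; rewrite leq_addr ltn_add2l ltnS.
by apply: leq_div2r; apply: ltnW.
Qed.

Lemma origin_lt r : (origin r < layer n b b)%N.
Proof.
case: r => [p|[k j]] /=.
  have /andP[_ h] := origin_level p; apply: leq_trans h _.
  exact: layer_mono.
by apply: leq_trans (ltn_ord j) _; apply: (@layer_mono n b 0).
Qed.

Definition layered_src (r : layered_request) : 'I_(layer n b b) :=
  Ordinal (origin_lt r).

(* Requests of [inr] stay unserved, so their value here is junk. *)
Definition layered_dst (r : layered_request) : 'I_(layer n b b) :=
  if r is inl p then (val p).2 else layered_src r.

Definition layered_height (i : 'I_(layer n b b)) : nat := height n b i.

Lemma height_src_inl (p : level_request) :
  layered_height (layered_src (inl p)) = (b - (val p).1.+1)%N.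
Proof. by have /andP[h1 h2] := origin_level p; apply: height_layer. Qed.

Lemma height_src_inr q : layered_height (layered_src (inr q)) = b.
Proof.
have := @height_gt n b q.2 0 b_gt0; rewrite /= ltn_ord subn0 => /esym bq.
by apply/eqP; rewrite eqn_leq height_le.
Qed.

Lemma layered_src_load i :
  (#|[pred r | layered_src r == i]| <= b)%N.
Proof.
(* The height of the source determines the level, and its index the quotient of the hub by [b]; the
   remainder then identifies the request. *)
pose key (r : layered_request) : nat :=
  match r with inl p => ((val p).2 %% b)%N | inr q => q.1 end.
rewrite cardE -(size_map key) -[leqRHS](size_iota 0).
apply: uniq_leq_size => [|x]; last first.
  by case/mapP=> -[p|q] _ ->; rewrite mem_iota //= ltn_mod.
rewrite map_inj_in_uniq ?enum_uniq // => r r'.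
rewrite !mem_enum !inE => /eqP ri /eqP r'i.
have hh : layered_height (layered_src r) = layered_height (layered_src r').
  by rewrite ri r'i.
have {ri r'i} : origin r = origin r'
  by have := congr1 val (etrans ri (esym r'i)).
case: r r' hh => [p|[k j]] [p'|[k' j']];
  rewrite ?height_src_inl ?height_src_inr /=.
- case: p p' => -[k j] /= jk [[k' j'] /= jk'] hk.
  have ekk : k = k'.
    by apply: val_inj => /=; have := ltn_ord k; have := ltn_ord k'; lia.
  subst k' => /addnI jdiv jmod; congr inl; apply: val_inj => /=; congr pair.
  by apply: val_inj; rewrite /= (divn_eq j b) jdiv jmod -divn_eq.
- by have := ltn_ord (val p).1; lia.
- by have := ltn_ord (val p').1; lia.
- by move=> _ jj kk; congr inr; congr pair; apply: val_inj.
Qed.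

Lemma in_routed_layered (r : layered_request) :
  (r \in routed b layered_src layered_height) =
  (if r is inl _ then true else false).
Proof.
rewrite inE; case: r => [p|q]; rewrite ?height_src_inl ?height_src_inr ?ltnn //.
by have := ltn_ord (val p).1; lia.
Qed.

Lemma layered_dst_up : {in routed b layered_src layered_height, forall r,
  (layered_height (layered_src r) < layered_height (layered_dst r))%N}.
Proof.
move=> r; rewrite in_routed_layered; case: r => [p|//] _.
rewrite height_src_inl /=; case: p => -[i j] /= ij.
have := ltn_ord i; have := height_gt n j (ltn_ord i).
by rewrite ij /layered_height; lia.
Qed.

Lemma layered_hit (j : 'I_(layer n b b)) k : (k < layered_height j)%N ->
  exists2 r, layered_height (layered_src r) = k & layered_dst r = j.
Proof.
move=> kj; have kb : (k < b)%N := leq_trans kj (height_le n b j).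
(* The sources of height [k] are those of level b - k - 1. *)
have ib : (b - k.+1 < b)%N by lia.
have jl : (j < layer n b (Ordinal ib))%N by rewrite height_gt //= subKn.
exists (inl (Sub (Ordinal ib, j) jl)) => //.
by rewrite height_src_inl /=; lia.
Qed.

Lemma layered_hit_inj : {in routed b layered_src layered_height &, forall r r',
  layered_height (layered_src r) = layered_height (layered_src r') ->
  layered_dst r = layered_dst r' -> r = r'}.
Proof.
move=> r r'; rewrite !in_routed_layered; case: r r' => [p|//] [p'|//] _ _.
rewrite !height_src_inl; case: p p' => -[k j] /= jk [[k' j'] /= jk'] hk jj.
congr inl; apply: val_inj => /=; congr pair => //.
by apply: val_inj; have := ltn_ord k; have := ltn_ord k'; move=> /=; lia.
Qed.

Lemma card_level_request : #|{: level_request}| = (\sum_(i < b) layer n b i)%N.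
Proof.
pose below (i : 'I_b) (j : 'I_(layer n b b)) := (j < layer n b i)%N.
rewrite card_sig -sum1_card -(pair_big_dep predT below (fun _ _ => 1%N)) /=.
apply: eq_bigr => i _.
rewrite (big_ord_narrow (layer_mono n b (ltnW (ltn_ord i)))) /=.
by rewrite sum1_card card_ord.
Qed.

Lemma card_routed_layered : #|routed b layered_src layered_height| =
  (\sum_(i < b) layer n b i)%N.
Proof.
rewrite -card_level_request 
  -[RHS](card_imset _ (@inl_inj _ ('I_b * 'I_n)%type)).
apply: eq_card => r; rewrite in_routed_layered; apply/esym.
by case: r => [p|q]; [rewrite imset_f|apply/imsetP => -[]].
Qed.

Lemma card_layered_request :
  #|{: layered_request}| = (\sum_(i < b) layer n b i + b * n)%N.
Proof. by rewrite card_sum card_level_request card_prod !card_ord. Qed.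

End LayeredRequests.

(** * The ratio for fixed parameters, then the limit *)

Lemma layered_ratio (R : realType) (g : path_function R) (c : R) (b n m : nat) :
  reasonable g -> (0 < b)%N -> (0 < n)%N -> b%:R <= c -> c < b.+1%:R ->
  (layer n b b * layer n b b + layer n b b <= m)%N ->
  exists (I : instance R) (f : routing I),
    [/\ #|edges I| = m,
        forall e, e \in edges I -> capacity e = c,
        output g f
      & expR 1 / (expR 1 - 1) - b%:R / (n + b)%:R / (expR 1 - 1)
          <= opt I / value f].
Proof.
move=> g_reasonable b_gt0 n_gt0 bc cb; set l := layer n b b => lm.
have c_gt0 : 0 < c by apply: lt_le_trans bc; rewrite ltr0n.
(* The graph needs [adj] source-to-hub and [l] hub-to-sink edges; leaves behind the sink bring the
   number up to exactly [m]. *)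
pose adj := #|[pred p : 'I_l * 'I_l |
  (layered_height p.1 <= layered_height p.2)%N]|.
have adj_le : (adj + l <= m)%N.
  apply: leq_trans lm; rewrite leq_add2r.
  by apply: leq_trans (max_card _) _; rewrite card_prod card_ord.
pose I := hub_instance (m - (adj + l)) (@layered_src n b)
  (@layered_height n b) c_gt0.
pose A := routed b (@layered_src n b) (@layered_height n b).
exists I, (hub_routing _ _ _ c_gt0 A (@layered_dst n b)); split.
- by rewrite card_hub_edges subnKC.
- by [].
- apply: (@output_dst _ _ _ b) => //.
  + exact: layered_dst_up.
  + exact: layered_hit.
  + exact: layered_hit_inj.
set S := (\sum_(i < b) layer n b i)%N.
have optS : (S + b * n)%:R <= opt I.
  rewrite -card_layered_request; apply: (@opt_ge _ _ _ b) => //.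
  exact: layered_src_load.
rewrite value_hub (card_routed_layered n b_gt0) -/S.
have S_gt0 : (0 < S)%N.
  rewrite /S; case: (b) b_gt0 => // b' _.
  by rewrite big_ord_recl /= ltn_addr.
have e_gt1 : 1 < expR 1 :> R by rewrite expR_gt1.
have nb_gt0 : 0 < (n + b)%:R :> R by rewrite ltr0n addn_gt0 n_gt0.
have Sle : S%:R <= b%:R * ((n + b)%:R * (expR 1 - 1)) :> R.
  have := sum_layer n b_gt0; rewrite -/S -(ler_nat R) natrD !natrM => h1.
  have h2 := layer_growth n b_gt0 R.
  have h3 : b%:R * (layer n b b + b)%:R <= b%:R * ((n + b)%:R * expR 1) :> R.
    by apply: ler_wpM2l h2.
  rewrite !natrD in h1 h3 *; lra.
rewrite ler_pdivlMr ?ltr0n //; apply: le_trans optS.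
have E_gt0 : 0 < expR 1 - 1 :> R by rewrite subr_gt0.
set E := expR 1 - 1 in E_gt0 Sle *.
have -> : expR 1 = E + 1 :> R by rewrite subrK.
(* In this form, multiplying by [S] and cancelling [S] reduces the goal to [Sle]. *)
have -> : (E + 1) / E - b%:R / (n + b)%:R / E = 1 + n%:R / ((n + b)%:R * E).
  have : (n + b)%:R != 0 :> R by rewrite gt_eqF.
  rewrite natrD => nb0; field.
  by rewrite nb0 gt_eqF.
rewrite mulrDl mul1r [leRHS]natrD lerD2l mulrAC ler_pdivrMr ?mulr_gt0 //.
rewrite natrM -mulrA [leRHS]mulrCA.
by apply: ler_wpM2l.
Qed.

Theorem theorem3 (R : realType) (B : nat -> R)
  (B_ge1 : \forall m \near \oo, 1 <= B m)
  (B_small : B =o_\oo (fun m : nat => Num.sqrt (m%:R : R)))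
  (g : path_function R) (g_reasonable : reasonable g) :
  exists eps : nat -> R, eps @ \oo --> (0 : R) /\
    \forall m \near \oo, exists (I : instance R) (f : routing I),
      [/\ #|edges I| = m,
          forall e, e \in edges I -> capacity e = B m,
          output g f
        & expR 1 / (expR 1 - 1) - eps m <= opt I / value f].
Proof.
have /eqoP Bo := B_small.
set e : R := expR 1.
have e_gt1 : 1 < e by rewrite expR_gt1.
(* This is B / (q (e - 1)) for the [q] chosen below; it bounds the error b / (n + b) / (e - 1). *)
exists (fun m => 4 * e / (e - 1) * (B m / Num.sqrt m%:R)); split.
  rewrite -[X in _ --> X](mulr0 (4 * e / (e - 1))).
  apply: cvgMr; apply/cvgr0Pnorm_le => d d0.
  have := Bo _ d0; apply: filterS => m.
  have [->|m0] := eqVneq (Num.sqrt m%:R : R) 0.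
    by move=> _; rewrite invr0 mulr0 normr0 ltW.
  by rewrite normrM normfV ler_pdivrMr ?normr_gt0.
have d0 : 0 < (4 * e)^-1 by rewrite invr_gt0; lra.
have Bq := Bo _ d0.
near=> m.
have B1 : 1 <= B m by near: m.
have Bs : `|B m| <= (4 * e)^-1 * `|Num.sqrt m%:R : R| by near: m.
have ms : (4 * e) ^+ 2 <= m%:R.
  near: m; exact: nbhs_infty_ger.
set s : R := Num.sqrt m%:R in Bs.
have es : 4 * e <= s.
  by rewrite -[4 * e]ger0_norm ?mulr_ge0 ?expR_ge0 // -sqrtr_sqr ler_wsqrtr.
have s2 : s ^+ 2 = m%:R by rewrite sqr_sqrtr.
(* With [n] and [b] at most [q], the number [l] of hubs is at most 2 q e = s / 2, so l^2 + l fits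
   into m = s^2. *)
pose q := s / (4 * e).
have q1 : 1 <= q by rewrite ler_pdivlMr ?mul1r //; lra.
have Bq' : B m <= q.
  have := le_trans (ler_norm _) Bs; rewrite [`|s|]ger0_norm ?sqrtr_ge0 // mulrC.
  by [].
pose b := Num.truncn (B m); pose n := Num.truncn q.
have /andP[b_le b_lt] : b%:R <= B m < b.+1%:R.
  by apply: truncn_itv; apply: le_trans B1.
have /andP[n_le n_lt] : n%:R <= q < n.+1%:R.
  by apply: truncn_itv; apply: le_trans q1.
have b_gt0 : (0 < b)%N by rewrite truncn_gt0.
have n_gt0 : (0 < n)%N by rewrite truncn_gt0.
have lm : (layer n b b * layer n b b + layer n b b <= m)%N.
  rewrite -(ler_nat R) natrD natrM -s2.
  have := layer_growth n b_gt0 R; rewrite -/e => h.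
  have ls : (layer n b b)%:R <= s / 2.
    have h1 : (n + b)%:R * e <= (2 * q) * e.
      by apply: ler_wpM2r; [exact: expR_ge0|rewrite natrD; lra].
    have h2 : 2 * q * e = s / 2.
      by rewrite /q; field; rewrite gt_eqF //; lra.
    have h3 : (layer n b b)%:R <= (layer n b b + b)%:R :> R.
      by rewrite ler_nat leq_addr.
    lra.
  have l0 : 0 <= (layer n b b)%:R :> R by [].
  by nra.
have [I [f [h1 h2 h3 h4]]] :=
  layered_ratio g_reasonable b_gt0 n_gt0 b_le b_lt lm.
exists I, f; split => //; apply: le_trans h4; rewrite lerD2l lerN2 -/e.
rewrite [leRHS](_ : _ = B m / q / (e - 1)); last first.
  by rewrite /q -/s; field; rewrite !gt_eqF //; lra.
apply: ler_wpM2r; first by rewrite invr_ge0; lra.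
apply: ler_pM => //.
(* Since [b] is at least 1, [n + b] is at least [n.+1], which exceeds [q]. *)
rewrite lef_pV2 ?posrE //.
- by apply: le_trans (ltW n_lt) _; rewrite ler_nat -addn1 leq_add2l.
- by rewrite ltr0n addn_gt0 n_gt0.
- by lra.
Unshelve. all: by end_near.
Qed.
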